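(* Under the ambiguity set of discrete distributions $\mathcal D_{\mathrm{dis}}$ defined in the context, the pessimistic bilevel program $$(\mathcal P):\quad\min_{x\in\mathcal X}\ w^\top x+\sup_{F\in\mathcal D_{\mathrm{dis}}}\mathbb E_F\Big[\max_{y\in\Omega(x,\xi)}v(\xi)^\top y\Big]$$ is equivalent to the 0-1 semidefinite program $$\min\ w^\top x+r+t$$ over $x\in\mathcal X$, symmetric $Q\in\mathbb R^{k\times k}$, $q\in\mathbb R^k$, $r,t,\lambda\in\mathbb R$, $\theta_i\in\mathbb R$, $p^s\in\mathbb R^m$, $y^s\in\mathbb R^n$, $\omega_i^s\in\mathbb R^m$ ($i=1,\dots,d$, $s=1,\dots,N$), subject to, for all $i=1,\dots,d$ and $s=1,\dots,N$, $$r\ge\sum_{j=1}^d(B_j\xi^s+b_j)^\top\omega_j^s+(B_0\xi^s+b_0)^\top p^s+c(\xi^s)^\top y^s-{\xi^s}^\top Q\xi^s-{\xi^s}^\top q,$$ $$A^\top p^s+\lambda c(\xi^s)=v(\xi^s),\qquad Ay^s\le\sum_{j=1}^d\theta_j(B_j\xi^s+b_j)+\lambda(B_0\xi^s+b_0),$$ $$t\ge(\gamma_2\Sigma_0+\mu_0\mu_0^\top)\cdot Q+\mu_0^\top q+\sqrt{\gamma_1}\,\|\Sigma_0^{1/2}(q+2Q\mu_0)\|,$$ $$p^s-(1-x_i)M\mathbf 1_m\le\omega_i^s\le p^s+(1-x_i)M\mathbf 1_m,\qquad -x_iM\mathbf 1_m\le\omega_i^s\le x_iM\mathbf 1_m,$$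 $$\lambda-M(1-x_i)\le\theta_i\le Mx_i,\qquad 0\le\theta_i\le\lambda,$$ $$Q\succeq0,\quad\lambda\ge0,\quad p^s\ge0,$$ where $M>0$ is a sufficiently large big-M constant.
   Context: Data. $\mathcal X\subseteq\{0,1\}^d$, $w\in\mathbb R^d$, $A\in\mathbb R^{m\times n}$; $c(\xi)=C\xi+c_0$, $v(\xi)=V\xi+v_0$ with $C,V\in\mathbb R^{n\times k}$, $c_0,v_0\in\mathbb R^n$; $b_x(\xi)=B_x\xi+b_{x0}$ with $B_x=\sum_{i=1}^dB_ix_i+B_0$, $b_{x0}=\sum_{i=1}^db_ix_i+b_0$, $B_i\in\mathbb R^{m\times k}$, $b_i\in\mathbb R^m$. $\Omega(x,\xi)=\arg\min_y\{c(\xi)^\top y:Ay\le b_x(\xi)\}$ is the set of all optimal follower's solutions. Ambiguity set. $\xi$ is supported on the finite set $\{\xi^1,\dots,\xi^N\}\subset\mathbb R^k$. Given $\mu_0\in\mathbb R^k$, a symmetric positive definite $\Sigma_0\in\mathbb R^{k\times k}$, $\gamma_1\ge0$, $\gamma_2\ge1$, $\mathcal D_{\mathrm{dis}}$ is the set of $p\in\mathbb R_+^N$ (identified with the distributions $\mathbb P(\xi=\xi^s)=p_s$) such that $\sum_sp_s=1$, $\big(\sum_sp_s\xi^s-\mu_0\big)^\top\Sigma_0^{-1}\big(\sum_sp_s\xi^s-\mu_0\big)\le\gamma_1$ and $\sum_sp_s(\xi^s-\mu_0)(\xi^s-\mu_0)^\top\preceq\gamma_2\Sigma_0$. Standing assumption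 (relatively complete recourse). $\{y\in\mathbb R^n:Ay\le b_x(\xi^s)\}$ is nonempty and bounded for every $x\in\mathcal X$ and every $s$. Notation. $X\cdot Y=\mathrm{Tr}(X^\top Y)$, $\|\cdot\|$ is the Euclidean norm, $\mathbf 1_m$ the all-ones vector, vector inequalities are componentwise. Equivalence means the same optimal value and the same optimal decisions $x$. *)

(* Defs.v *)
From HB Require Import structures.
From mathcomp Require Import all_boot all_order all_algebra.
From mathcomp Require Import all_classical all_reals all_analysis.

Set Implicit Arguments.
Unset Strict Implicit.
Unset Printing Implicit Defensive.

Import Order.TTheory GRing.Theory Num.Theory.
Import numFieldNormedType.Exports.
Local Open Scope classical_set_scope.
Local Open Scope ring_scope.

Section LinearAlgebra.
Context {R : realType}.

Definition dotv n (a b : 'cV[R]_n) : R := (a^T *m b) 0 0.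

Definition frobdot m n (A B : 'M[R]_(m, n)) : R := \tr (A^T *m B).

(* The norm `|a| that MathComp-Analysis puts on matrices is the sup norm. *)
Definition norm2 n (a : 'cV[R]_n) : R := Num.sqrt (\sum_i a i 0 ^+ 2).

Definition lecv n (a b : 'cV[R]_n) : Prop := forall i, a i 0 <= b i 0.

Definition psdmx n (A : 'M[R]_n) : Prop :=
  A^T = A /\ forall z : 'cV[R]_n, 0 <= dotv z (A *m z).

Definition pdmx n (A : 'M[R]_n) : Prop :=
  A^T = A /\ forall z : 'cV[R]_n, z != 0 -> 0 < dotv z (A *m z).

Definition lemx_psd n (A B : 'M[R]_n) : Prop := psdmx (B - A).

(* The symmetric positive semidefinite square root; it exists and is unique
   when A is positive semidefinite, otherwise the value 0 is irrelevant. *)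
Definition sqrtmx n (A : 'M[R]_n) : 'M[R]_n :=
  xget 0 [set S | psdmx S /\ S *m S = A].

End LinearAlgebra.

(* d leader's binary variables, m follower's constraints, n follower's
   variables, k the dimension of the random vector, N its number of scenarios. *)
Record bilevel_data (R : realType) (d m n k N : nat) := BilevelData {
  Xset : set 'cV[R]_d;
  wvec : 'cV[R]_d;
  Amat : 'M[R]_(m, n);
  Cmat : 'M[R]_(n, k);
  c0 : 'cV[R]_n;
  Vmat : 'M[R]_(n, k);
  v0 : 'cV[R]_n;
  Bmat : 'I_d -> 'M[R]_(m, k);
  Bmat0 : 'M[R]_(m, k);
  bvec : 'I_d -> 'cV[R]_m;
  bvec0 : 'cV[R]_m;
  scen : 'I_N -> 'cV[R]_k;
  mu0 : 'cV[R]_k;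
  Sigma0 : 'M[R]_k;
  gamma1 : R;
  gamma2 : R
}.

Section BilevelProgram.
Context {R : realType} {d m n k N : nat}.
Variable D : bilevel_data R d m n k N.

Definition cost (xi : 'cV[R]_k) : 'cV[R]_n := Cmat D *m xi + c0 D.

Definition vcost (xi : 'cV[R]_k) : 'cV[R]_n := Vmat D *m xi + v0 D.

Definition rhs (x : 'cV[R]_d) (xi : 'cV[R]_k) : 'cV[R]_m :=
  (\sum_i x i 0 *: Bmat D i + Bmat0 D) *m xi
    + (\sum_i x i 0 *: bvec D i + bvec0 D).

Definition follower_feasible (x : 'cV[R]_d) (xi : 'cV[R]_k) : set 'cV[R]_n :=
  [set y | lecv (Amat D *m y) (rhs x xi)].

Definition Omega (x : 'cV[R]_d) (xi : 'cV[R]_k) : set 'cV[R]_n :=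
  [set y | follower_feasible x xi y /\
    forall y', follower_feasible x xi y' ->
      dotv (cost xi) y <= dotv (cost xi) y'].

Definition relatively_complete_recourse : Prop :=
  forall x s, Xset D x ->
    follower_feasible x (scen D s) !=set0 /\
    bounded_set (follower_feasible x (scen D s)).

(* A distribution on the scenarios is identified with its weights. *)
Definition mean_dev (p : 'I_N -> R) : 'cV[R]_k :=
  \sum_s p s *: scen D s - mu0 D.

Definition Ddis : set ('I_N -> R) :=
  [set p | [/\ forall s, 0 <= p s,
              \sum_s p s = 1,
              dotv (mean_dev p) (invmx (Sigma0 D) *m mean_dev p) <= gamma1 D
            & lemx_psd
                (\sum_s p s *: ((scen D s - mu0 D) *m (scen D s - mu0 D)^T))
                (gamma2 D *: Sigma0 D)]].

Definition pessimistic_value (x : 'cV[R]_d) (xi : 'cV[R]_k) : \bar R :=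
  ereal_sup [set (dotv (vcost xi) y)%:E | y in Omega x xi].

Definition dis_expectation (p : 'I_N -> R) (h : 'cV[R]_k -> \bar R) : \bar R :=
  (\sum_s (p s)%:E * h (scen D s))%E.

Definition bilevel_obj (x : 'cV[R]_d) : \bar R :=
  ((dotv (wvec D) x)%:E
    + ereal_sup [set dis_expectation p (pessimistic_value x) | p in Ddis])%E.

Definition bilevel_value : \bar R :=
  ereal_inf [set bilevel_obj x | x in Xset D].

Definition bilevel_optimal (x : 'cV[R]_d) : Prop :=
  Xset D x /\ bilevel_obj x = bilevel_value.

End BilevelProgram.

(* The decision variables of the semidefinite program other than x. *)
Record sdp_vars (R : realType) (d m n k N : nat) := SdpVars {
  varQ : 'M[R]_k;
  varq : 'cV[R]_k;
  varr : R;
  vart : R;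
  varlam : R;
  vartheta : 'I_d -> R;
  varp : 'I_N -> 'cV[R]_m;
  vary : 'I_N -> 'cV[R]_n;
  varomega : 'I_d -> 'I_N -> 'cV[R]_m
}.

Section SemidefiniteProgram.
Context {R : realType} {d m n k N : nat}.
Variable D : bilevel_data R d m n k N.
Variable M : R.

Definition rhs_coef (i : 'I_d) (xi : 'cV[R]_k) : 'cV[R]_m :=
  Bmat D i *m xi + bvec D i.

Definition rhs_coef0 (xi : 'cV[R]_k) : 'cV[R]_m := Bmat0 D *m xi + bvec0 D.

Definition sdp_feasible (x : 'cV[R]_d) (u : sdp_vars R d m n k N) : Prop :=
  let: SdpVars Q q r t lam theta p y omega := u in
  let ones : 'cV[R]_m := const_mx 1 in
  [/\ Xset D x,
      (forall s : 'I_N,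
        [/\ \sum_j dotv (rhs_coef j (scen D s)) (omega j s)
              + dotv (rhs_coef0 (scen D s)) (p s)
              + dotv (cost D (scen D s)) (y s)
              - dotv (scen D s) (Q *m scen D s) - dotv (scen D s) q <= r,
            (Amat D)^T *m p s + lam *: cost D (scen D s) = vcost D (scen D s),
            lecv (Amat D *m y s)
              (\sum_j theta j *: rhs_coef j (scen D s)
                + lam *: rhs_coef0 (scen D s))
          & lecv 0 (p s)]),
      frobdot (gamma2 D *: Sigma0 D + mu0 D *m (mu0 D)^T) Q
        + dotv (mu0 D) q
        + Num.sqrt (gamma1 D)
          * norm2 (sqrtmx (Sigma0 D) *m (q + 2 *: (Q *m mu0 D))) <= t,
      (forall (i : 'I_d) (s : 'I_N),
        [/\ lecv (p s - ((1 - x i 0) * M) *: ones) (omega i s),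
            lecv (omega i s) (p s + ((1 - x i 0) * M) *: ones),
            lecv (- (x i 0 * M) *: ones) (omega i s)
          & lecv (omega i s) ((x i 0 * M) *: ones)])
    & [/\ forall i : 'I_d, lam - M * (1 - x i 0) <= theta i <= M * x i 0,
          forall i : 'I_d, 0 <= theta i <= lam,
          psdmx Q
        & 0 <= lam]].

Definition sdp_obj (x : 'cV[R]_d) (u : sdp_vars R d m n k N) : R :=
  dotv (wvec D) x + varr u + vart u.

Definition sdp_value : \bar R :=
  ereal_inf [set (sdp_obj z.1 z.2)%:E | z in [set z | sdp_feasible z.1 z.2]].

Definition sdp_value_at (x : 'cV[R]_d) : \bar R :=
  ereal_inf [set (sdp_obj x u)%:E | u in [set u | sdp_feasible x u]].

(* x minimizes the program after partial minimization over the other variables.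
   This does not ask that the minimum over u be attained: for a fixed x it may
   fail to be, since no Slater condition is assumed on the ambiguity set. *)
Definition sdp_optimal (x : 'cV[R]_d) : Prop :=
  Xset D x /\ sdp_value_at x = sdp_value.

Definition sdp_minimizer (x : 'cV[R]_d) (u : sdp_vars R d m n k N) : Prop :=
  sdp_feasible x u /\
  forall x' u', sdp_feasible x' u' -> sdp_obj x u <= sdp_obj x' u'.

End SemidefiniteProgram.

(* Main.v *)
(* For fixed x the pessimistic follower value in scenario s is a linear program
   whose dual is attained; its multiplier lam of the follower's optimality
   constraint can be increased at will, so one lam serves all scenarios, and as
   there are finitely many x and s the dual solutions are bounded by a single M.
   For binary x the big-M constraints say exactly theta_i = x_i lam and
   omega_i^s = x_i p^s.

   The worst case over Ddis is dualized without any Slater condition.  A weight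
   vector outside Ddis is separated from it by some (Q, q) along which the
   Lagrangian tends to -oo.  Since the simplex is compact, finitely many (Q, q)
   bring the Lagrangian below any value beta exceeding the supremum at every
   point of the simplex; Farkas' lemma (the minimax theorem for matrix games)
   then gives one convex combination of them that does so uniformly, because
   moment_bound is sublinear.  If Ddis is empty both values are -oo. *)
Require Import Defs.
From HB Require Import structures.
From mathcomp Require Import all_boot all_order all_algebra finmap.
From mathcomp Require Import all_classical all_reals all_analysis.
From mathcomp Require Import complex ring lra.

Set Implicit Arguments.
Unset Strict Implicit.
Unset Printing Implicit Defensive.

Import Order.TTheory GRing.Theory Num.Theory.
Import numFieldNormedType.Exports.
Local Open Scope classical_set_scope.
Local Open Scope ring_scope.

(** * Farkas' lemma for finitely many linear forms *)

Section Farkas.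
Context {R : realFieldType} {W : lmodType R}.

(** Induction on the number of forms: either the first form is redundant and gets multiplier 0, or
    some [w0] violates the implication once it is dropped. *)
Let farkas_ord m (a : 'I_m -> W -> R) (c : W -> R) :
    (forall i, scalar (a i)) -> scalar c ->
    (forall w, (forall i, a i w <= 0) -> c w <= 0) ->
  exists2 u : 'I_m -> R, forall i, 0 <= u i
                       & forall w, c w = \sum_i u i * a i w.
Proof.
elim: m a c => [|m IHm] a c lin_a lin_c le_c.
  (* With no constraint, [c] is nonpositive at [w] and at [-1 *: w], hence zero. *)
  exists (fun=> 0) => // w; rewrite big_ord0; apply/eqP; rewrite eq_le.
  have lec0 v : c v <= 0 by apply: le_c => -[].
  have := lin_c (-1) w w; have := lin_c (-1) w 0.
  have := lec0 w; have := lec0 (-1 *: w + w); have := lec0 (-1 *: w + 0).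
  have := lec0 0; have := lin_c 1 0 0; rewrite scaler0 addr0 /=.
  by move=> *; apply/andP; split; lra.
case: (pselect (forall w, (forall i, a (lift ord0 i) w <= 0) -> c w <= 0)).
  move=> /(IHm _ _ (fun i => lin_a _) lin_c) [u u_ge0 cE].
  exists (fun i => oapp u 0 (unlift ord0 i)) => [i|w].
    by case: unliftP => /=.
  rewrite cE big_ord_recl unlift_none mul0r add0r.
  by apply: eq_bigr => i _; rewrite liftK.
move=> /existsNP[w0 /not_implyP[aw0 /negP]]; rewrite -ltNge => cw0.
have a0w0 : 0 < a ord0 w0.
  rewrite ltNge; apply/negP => a0w0; move: cw0; rewrite ltNge => /negP; apply.
  by apply: le_c => i; case: (unliftP ord0 i) => [j|] ->.
(* Bartl: project along w0 onto the kernel of a 0, which removes a 0 from the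
   system. *)
pose k w := a ord0 w / a ord0 w0.
have lin_k : scalar k by move=> x v w; rewrite /k lin_a /=; ring.
pose proj f w : R := f w - k w * f w0.
have lin_proj f : scalar f -> scalar (proj f).
  by move=> lin_f x v w; rewrite /proj lin_f lin_k /=; ring.
have projE f w : scalar f -> proj f w = f (- k w *: w0 + w).
  by move=> lin_f; rewrite lin_f /proj /=; ring.
have [w /= w_le|u u_ge0 cE] := IHm (fun i => proj (a (lift ord0 i))) (proj c)
  (fun i => lin_proj _ (lin_a _)) (lin_proj _ lin_c).
  rewrite projE//; apply: le_c => i; rewrite -projE//.
  case: (unliftP ord0 i) => [j|] ->; first exact: w_le.
  by rewrite /proj /k divfK ?subrr// gt_eqF.
(* This value is forced by evaluating the desired identity at [w0]; it is nonnegative because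
   [c w0 > 0] while the other forms are nonpositive there. *)
pose u0 := (c w0 - \sum_i u i * a (lift ord0 i) w0) / a ord0 w0.
exists (fun i => oapp u u0 (unlift ord0 i)) => [i|w].
  case: unliftP => //= _; rewrite divr_ge0 ?(ltW a0w0)// subr_ge0.
  rewrite (le_trans _ (ltW cw0))//; apply: sumr_le0 => j _.
  by rewrite mulr_ge0_le0.
rewrite big_ord_recl unlift_none /=.
under eq_bigr do rewrite liftK /=.
move: (cE w); rewrite /proj /u0 /k /=.
under [in RHS]eq_bigr do rewrite mulrBr mulrCA.
rewrite sumrB -mulr_sumr => /eqP; rewrite subr_eq => /eqP ->.
by field; rewrite gt_eqF.
Qed.

Lemma farkas (I : finType) (a : I -> W -> R) (c : W -> R) :
    (forall i, scalar (a i)) -> scalar c ->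
    (forall w, (forall i, a i w <= 0) -> c w <= 0) ->
  exists2 u : I -> R, forall i, 0 <= u i
                    & forall w, c w = \sum_i u i * a i w.
Proof.
move=> lin_a lin_c le_c.
have [w w_le|u u_ge0 cE] :=
  @farkas_ord #|I| (fun i => a (enum_val i)) c (fun i => lin_a _) lin_c.
  by apply: le_c => i; rewrite -(enum_rankK i).
exists (fun i => u (enum_rank i)) => // w.
rewrite cE (reindex enum_rank) /=; last first.
  by exists enum_val => i _; [exact: enum_rankK|exact: enum_valK].
by apply: eq_bigr => i _; rewrite enum_rankK.
Qed.

End Farkas.

(** * Inner product and componentwise order of column vectors *)

Section DotProduct.
Context {R : realType}.

Lemma dotvE n (a b : 'cV[R]_n) : dotv a b = \sum_i a i 0 * b i 0.
Proof. by rewrite /dotv mxE; apply: eq_bigr => i _; rewrite mxE. Qed.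

Lemma dotvC n (a b : 'cV[R]_n) : dotv a b = dotv b a.
Proof. by rewrite !dotvE; apply: eq_bigr => i _; rewrite mulrC. Qed.

Fact dotv_is_scalar n (a : 'cV[R]_n) : scalar (dotv a).
Proof. by move=> k b c; rewrite /dotv mulmxDr -scalemxAr !mxE. Qed.

HB.instance Definition _ n (a : 'cV[R]_n) :=
  GRing.isLinear.Build R 'cV[R]_n R *%R (dotv a) (dotv_is_scalar a).

Lemma dotvDr n (a b c : 'cV[R]_n) : dotv a (b + c) = dotv a b + dotv a c.
Proof. exact: linearD. Qed.

Lemma dotvZr n k (a b : 'cV[R]_n) : dotv a (k *: b) = k * dotv a b.
Proof. exact: linearZ. Qed.

Lemma dotvNr n (a b : 'cV[R]_n) : dotv a (- b) = - dotv a b.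
Proof. exact: raddfN. Qed.

Lemma dotv0r n (a : 'cV[R]_n) : dotv a 0 = 0.
Proof. exact: raddf0. Qed.

Lemma dotv_sumr n (I : Type) (r : seq I) (P : pred I) (a : 'cV[R]_n)
    (F : I -> 'cV[R]_n) :
  dotv a (\sum_(i <- r | P i) F i) = \sum_(i <- r | P i) dotv a (F i).
Proof. exact: raddf_sum. Qed.

Lemma dotvDl n (a b c : 'cV[R]_n) : dotv (a + b) c = dotv a c + dotv b c.
Proof. by rewrite dotvC dotvDr !(dotvC c). Qed.

Lemma dotvZl n k (a b : 'cV[R]_n) : dotv (k *: a) b = k * dotv a b.
Proof. by rewrite dotvC dotvZr (dotvC b). Qed.

Lemma dotvNl n (a b : 'cV[R]_n) : dotv (- a) b = - dotv a b.
Proof. by rewrite dotvC dotvNr (dotvC b). Qed.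

Lemma dotv0l n (a : 'cV[R]_n) : dotv 0 a = 0.
Proof. by rewrite dotvC dotv0r. Qed.

Lemma dotv_suml n (I : Type) (r : seq I) (P : pred I) (a : 'cV[R]_n)
    (F : I -> 'cV[R]_n) :
  dotv (\sum_(i <- r | P i) F i) a = \sum_(i <- r | P i) dotv (F i) a.
Proof. by rewrite dotvC dotv_sumr; apply: eq_bigr => i _; rewrite dotvC. Qed.

Lemma dotv_mulmxr m n (a : 'cV[R]_m) (A : 'M[R]_(m, n)) (b : 'cV[R]_n) :
  dotv a (A *m b) = dotv (A^T *m a) b.
Proof. by rewrite /dotv trmx_mul trmxK mulmxA. Qed.

Lemma dotv_mulmxl m n (a : 'cV[R]_m) (A : 'M[R]_(m, n)) (b : 'cV[R]_n) :
  dotv (A *m b) a = dotv b (A^T *m a).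
Proof. by rewrite dotvC dotv_mulmxr dotvC. Qed.

Lemma dotv_ge0 n (a b : 'cV[R]_n) : lecv 0 a -> lecv 0 b -> 0 <= dotv a b.
Proof.
move=> a_ge0 b_ge0; rewrite dotvE; apply: sumr_ge0 => i _.
by apply: mulr_ge0; [have := a_ge0 i|have := b_ge0 i]; rewrite mxE.
Qed.

Lemma ler_dotv n (a b c : 'cV[R]_n) :
  lecv 0 a -> lecv b c -> dotv a b <= dotv a c.
Proof.
move=> a_ge0 le_bc; rewrite -subr_ge0 -dotvNr -dotvDr dotv_ge0// => i.
by rewrite !mxE subr_ge0.
Qed.

(** Turns an identity of linear forms, as [farkas] provides, into an equation between coefficient
    vectors. *)
Lemma dotv_inj n (a b : 'cV[R]_n) :
  (forall c, dotv a c = dotv b c) -> a = b.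
Proof.
have dotv_delta i (v : 'cV[R]_n) : dotv v (delta_mx i 0) = v i 0.
  rewrite dotvE (bigD1 i)//= mxE !eqxx mulr1 big1 ?addr0// => j ji.
  by rewrite mxE (negPf ji) mulr0.
by move=> ab; apply/colP => i; rewrite -!dotv_delta ab.
Qed.

Lemma dotv_col_mx m n (a c : 'cV[R]_m) (b e : 'cV[R]_n) :
  dotv (col_mx a b) (col_mx c e) = dotv a c + dotv b e.
Proof. by rewrite /dotv tr_col_mx mul_row_col mxE. Qed.

Lemma lecv_col_mx m n (a c : 'cV[R]_m) (b e : 'cV[R]_n) :
  lecv (col_mx a b) (col_mx c e) <-> lecv a c /\ lecv b e.
Proof.
split=> [le_abce|[le_ac le_be] i].
  split=> i; first by have := le_abce (lshift n i); rewrite !col_mxEu.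
  by have := le_abce (rshift m i); rewrite !col_mxEd.
by rewrite -(splitK i); case: (fintype.split i) => j /=;
  rewrite ?col_mxEu ?col_mxEd.
Qed.

End DotProduct.

(** * Linear programming duality *)

Section LinearProgramming.
Context {R : realType} {m n : nat}.
Implicit Types (A : 'M[R]_(m, n)) (b : 'cV[R]_m) (c : 'cV[R]_n).

(** Homogenization: for [s > 0] the pair [(y, s)] stands for the point [s^-1 *: y], so affine
    constraints become linear forms to which [farkas] applies. *)
Let homog A b i (w : 'cV[R]_n * R^o) : R := (A *m w.1) i 0 - b i 0 * w.2.

Let scalar_homog A b i : scalar (homog A b i).
Proof.
move=> k [y s] [z t]; rewrite /homog /= mulmxDr -scalemxAr !mxE.
by rewrite /GRing.scale /=; ring.
Qed.

Let sum_homog A b (u : 'cV_m) w :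
  \sum_i u i 0 * homog A b i w = dotv (A^T *m u) w.1 - dotv b u * w.2.
Proof.
rewrite -dotv_mulmxr (dotvC b) !dotvE mulr_suml -sumrB.
by apply: eq_bigr => i _; rewrite /homog mulrBr mulrA.
Qed.

(** Infeasibility says that the homogenized constraints force the scale coordinate to be
    nonpositive. Evaluating the resulting identity at [(y, 0)] and [(0, 1)] yields the two
    equations. *)
Lemma farkas_infeasible A b :
    (forall y, ~ lecv (A *m y) b) ->
  exists u, [/\ lecv 0 u, A^T *m u = 0 & dotv b u = -1].
Proof.
move=> infeas.
have [//|w w_le|u u_ge0 uE] := farkas (scalar_homog A b)
  (c := fun w : 'cV[R]_n * R^o => w.2 : R) _ _.
  rewrite leNgt; apply/negP => w2_gt0; apply: (infeas (w.2^-1 *: w.1)) => i.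
  rewrite -scalemxAr mxE ler_pdivrMl// mulrC.
  by have := w_le i; rewrite /homog subr_le0.
pose v := \col_i u i; have vE w : w.2 = dotv (A^T *m v) w.1 - dotv b v * w.2.
  by rewrite [LHS]uE -sum_homog; apply: eq_bigr => i _; rewrite mxE.
exists v; split=> [i||]; first by rewrite !mxE.
  apply: dotv_inj => y; have /esym := vE (y, 0).
  by rewrite /= mulr0 subr0 dotv0l.
have := vE (0, 1); rewrite /= mulr1 dotv0r; lra.
Qed.

Lemma farkas_affine A b c (beta : R) :
    (exists y, lecv (A *m y) b) ->
    (forall y, lecv (A *m y) b -> dotv c y <= beta) ->
  exists u, [/\ lecv 0 u, A^T *m u = c & dotv b u <= beta].
Proof.
move=> [y0 Ay0] le_beta.
(* The index [None] carries the extra constraint that the scale be nonnegative. *)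
pose a i (w : 'cV[R]_n * R^o) : R := oapp (fun i => homog A b i w) (- w.2) i.
have [[i|]|||u u_ge0 uE] := farkas (a := a)
  (c := fun w => dotv c w.1 - beta * w.2) _ _ _.
- exact: scalar_homog.
- by move=> k v w /=; rewrite opprD mulrN.
- move=> k v w /=; rewrite dotvDr dotvZr /GRing.scale /=; ring.
- move=> [y t] w_le /=; rewrite subr_le0.
  have t_ge0 : 0 <= t by have := w_le None; rewrite oppr_le0.
  have yt i : (A *m y) i 0 <= b i 0 * t.
    by have := w_le (Some i); rewrite /= /homog subr_le0.
  have [t_gt0|] := ltP 0 t.
    rewrite -ler_pdivrMr// mulrC -dotvZr; apply: le_beta => i.
    by rewrite -scalemxAr mxE mulrC ler_pdivrMr.
  move=> t_le0; have {t_ge0 t_le0} t0 : t = 0 by apply/le_anti/andP.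
  rewrite t0 mulr0 leNgt; apply/negP => cy_gt0.
  (* At scale 0, [y] is a recession direction; this step length would lift the objective from its
     value at [y0] to [beta + 1]. *)
  pose s := (beta - dotv c y0 + 1) / dotv c y.
  have : dotv c (y0 + s *: y) <= beta.
    apply: (le_beta) => i; rewrite mulmxDr -scalemxAr mxE -[leRHS]addr0.
    rewrite lerD// mxE mulr_ge0_le0//; last by have := yt i; rewrite t0 mulr0.
    by rewrite divr_ge0 ?(ltW cy_gt0)// addr_ge0// subr_ge0 le_beta.
  by rewrite dotvDr dotvZr /s divfK ?gt_eqF//; lra.
pose v := \col_i u (Some i).
have vE w : dotv c w.1 - beta * w.2 =
    dotv (A^T *m v) w.1 - dotv b v * w.2 - u None * w.2.
  rewrite [LHS]uE (bigD1 None)//= -sum_homog addrC mulrN; congr (_ - _).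
  rewrite (reindex_omap Some id) => [|[]//]; apply: eq_big => [i|i _].
    by rewrite eqxx.
  by rewrite /= mxE.
exists v; split=> [i||]; first by rewrite !mxE.
  apply: dotv_inj => y; have /esym := vE (y, 0).
  by rewrite /= !mulr0 !subr0.
have := vE (0, 1); rewrite /= !mulr1 !dotv0r; have := u_ge0 None; lra.
Qed.

End LinearProgramming.

(** Attainment comes first: were the supremum missed, a Farkas certificate for the system with
    [c y >= sup S] added would lower the supremum by a positive amount. At the maximum,
    [farkas_affine] then supplies the dual solution. *)
Lemma lp_duality {R : realType} {m n : nat} (A : 'M[R]_(m, n)) b c (B : R) :
    (exists y, lecv (A *m y) b) ->
    (forall y, lecv (A *m y) b -> dotv c y <= B) ->
  exists y u, [/\ lecv (A *m y) b, lecv 0 u, A^T *m u = c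
                & dotv b u = dotv c y].
Proof.
move=> [y0 Ay0] le_B.
pose S := [set dotv c y | y in [set y | lecv (A *m y) b]].
have S_sup : has_sup S.
  by split; [exists (dotv c y0), y0|exists B => _ [y /le_B ? <-]].
have le_sup y : lecv (A *m y) b -> dotv c y <= sup S.
  by move=> Ay; apply: sup_upper_bound => //; exists y.
have [y Ay cy] : exists2 y, lecv (A *m y) b & sup S <= dotv c y.
  apply: contrapT => no_y.
  have [y /[!mul_col_mx] /lecv_col_mx[Ay /(_ 0)]|u] := @farkas_infeasible _ _ _
      (col_mx A (- c^T)) (col_mx b (const_mx (- sup S))).
    rewrite mulNmx !mxE lerN2 => cy; apply: no_y; exists y => //.
    by rewrite /dotv mxE.
  move=> [u_ge0].
  have /lecv_col_mx[v_ge0 t_ge0] :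
      lecv (col_mx 0 0) (col_mx (usubmx u) (dsubmx u)).
    by rewrite col_mx0 vsubmxK.
  rewrite -[u in _ *m u]vsubmxK -[u in dotv _ u]vsubmxK.
  move: (usubmx u) (dsubmx u) v_ge0 t_ge0 => v t v_ge0 t_ge0.
  rewrite tr_col_mx mul_row_col linearN /= trmxK mulNmx dotv_col_mx.
  move=> /eqP; rewrite subr_eq0 => /eqP vE.
  have {}vE y : dotv v (A *m y) = t 0 0 * dotv c y.
    by rewrite dotv_mulmxr vE [t]mx11_scalar mul_mx_scalar dotvZl mxE mulr1n.
  have -> : dotv (const_mx (- sup S)) t = - (t 0 0 * sup S).
    by rewrite dotvE big_ord1 mxE mulNr mulrC.
  move=> bvE.
  have le_bv y : lecv (A *m y) b -> t 0 0 * dotv c y <= t 0 0 * sup S - 1.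
    move=> Ay; rewrite -vE (le_trans (ler_dotv v_ge0 Ay))// dotvC.
    move: bvE; lra.
  (* A zero multiplier would make [v] certify that [A y <= b] has no solution, against [y0]. *)
  have t_gt0 : 0 < t 0 0.
    have := t_ge0 0; rewrite mxE le_eqVlt => /predU1P[t0|//].
    by have := le_bv _ Ay0; rewrite -t0; lra.
  suff : sup S <= sup S - (t 0 0)^-1.
    by rewrite lerBrDr gerDl leNgt invr_gt0 t_gt0.
  apply: ge_sup; first by case: S_sup.
  move=> _ [y Ay <-]; rewrite -(ler_pM2l t_gt0) mulrBr divff ?gt_eqF//.
  exact: le_bv.
have cyE : dotv c y = sup S by apply/le_anti; rewrite cy le_sup.
have [|//|u [u_ge0 Au bu]] := @farkas_affine _ _ _ A b c (dotv c y).
- by exists y.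
- by move=> z /le_sup; rewrite cyE.
exists y, u; split=> //; apply/le_anti; rewrite bu/=.
by rewrite -Au -dotv_mulmxr (dotvC b) ler_dotv.
Qed.

(** * Roots of positive semidefinite matrices *)

Section SymmetricMatrices.
Context {R : realType}.

Lemma poly_interpolation (s : seq R) (f : R -> R) :
  exists p : {poly R}, forall x, x \in s -> p.[x] = f x.
Proof.
elim: s => [|x s [p pE]]; first by exists 0.
have [xs|xs] := boolP (x \in s).
  by exists p => y; rewrite inE => /predU1P[->|]; exact: pE.
pose q := \prod_(a <- s) ('X - a%:P).
have qx : q.[x] != 0 by rewrite -/(root q x) root_prod_XsubC.
exists (p + ((f x - p.[x]) / q.[x]) *: q) => y; rewrite hornerD hornerZ inE.
move=> /predU1P[->|ys]; first by rewrite divfK// addrC subrK.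
have /eqP -> : q.[y] == 0 by rewrite -/(root q y) root_prod_XsubC.
by rewrite mulr0 addr0 pE.
Qed.

(** Gives the symmetry of the root below, a real polynomial in a symmetric matrix. *)
Lemma trmx_horner n (A : 'M[R]_n.+1) p :
  (horner_mx A p)^T = horner_mx A^T p.
Proof.
elim/poly_ind: p => [|p c IHp]; first by rewrite !rmorph0 trmx0.
rewrite !rmorphD !rmorphM /= !horner_mx_X !horner_mx_C linearD /= tr_scalar_mx.
by congr (_ + _); rewrite trmx_mul IHp; apply: comm_mx_horner.
Qed.

Lemma psdmx_eigenvalue_ge0 n (A : 'M[R]_n) a :
  psdmx A -> eigenvalue A a -> 0 <= a.
Proof.
move=> [AT A_ge0] /eigenvalueP[v vA v_neq0].
have := A_ge0 v^T; have -> : A *m v^T = a *: v^T.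
  by rewrite -{1}AT -trmx_mul vA linearZ.
rewrite dotvZr pmulr_lge0// dotvE lt_def sumr_ge0 ?andbT; last first.
  by move=> i _; rewrite -expr2 sqr_ge0.
rewrite psumr_neq0 => [|i _]; last by rewrite -expr2 sqr_ge0.
have [i vi] := rV0Pn _ v_neq0.
apply/hasP; exists i; first exact: mem_index_enum.
by rewrite /= mxE -expr2 exprn_even_gt0.
Qed.

(* The root is a polynomial in A, interpolating at the eigenvalues of A, which
   the spectral theorem over R[i] provides.  A fourth root is used because its
   square is a square root that is visibly positive semidefinite. *)
Lemma psdmx_fourth_root n (A : 'M[R]_n) : psdmx A ->
  exists2 T : 'M[R]_n, T^T = T & (T *m T) *m (T *m T) = A.
Proof.
case: n A => [|n] A psdA; first by exists 0; apply/matrixP => -[].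
pose C : numClosedFieldType := R[i]%C.
pose f : {rmorphism R -> C} := real_complex R.
pose Ac := map_mx f A; have AT := psdA.1.
have Asym : Ac \is hermsymmx.
  apply: realsym_hermsym.
    apply/is_hermitianmxP; rewrite expr0 scale1r map_mx_id//.
    by rewrite /Ac map_trmx AT.
  by apply/mxOverP => i j; rewrite mxE complex_real.
have := hermitian_spectral_diag_real Asym.
have /orthomx_spectralP := hermitian_normalmx Asym.
have := spectral_unit Ac; move: (spectralmx Ac) (spectral_diag Ac).
move=> P d Punit AcE d_real.
(* The rows of [P] are left eigenvectors, so each [d 0 i] is an eigenvalue of [Ac]; being real, it
   is also one of [A], hence nonnegative. *)
have {d_real} eig_d i : exists2 e, 0 <= e & d 0 i = f e.
  have : eigenvalue Ac (d 0 i).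
    apply/eigenvalueP; exists (row i P); last first.
      apply: contraTneq Punit => Pi0; rewrite unitmxE (expand_det_row _ i).
      rewrite big1 ?unitr0// => j _; have /rowP/(_ j) := Pi0.
      by rewrite !mxE => ->; rewrite mul0r.
    rewrite AcE -row_mul !mulmxA mulmxV// mul1mx row_mul.
    by rewrite row_diag_mx -scalemxAl -rowE.
  have /complex_realP[e ->] := mxOverP d_real 0 i.
  rewrite eigenvalue_root_char -map_char_poly fmorph_root.
  by rewrite -eigenvalue_root_char => /(psdmx_eigenvalue_ge0 psdA); exists e.
pose r (x : R) := Num.sqrt (Num.sqrt x).
have [p pE] := poly_interpolation [seq complex.Re (d 0 i) | i : 'I_n.+1] r.
exists (horner_mx A p); first by rewrite trmx_horner AT.
apply: (@map_mx_inj _ _ f); rewrite !map_mxM /= map_horner_mx -/Ac AcE.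
rewrite horner_mx_uconjC// horner_mx_diag.
have cancel X Y :
    (invmx P *m X *m P) *m (invmx P *m Y *m P) = invmx P *m (X *m Y) *m P.
  by rewrite !mulmxA mulmxK.
rewrite !cancel.
congr (_ *m _ *m _).
rewrite !mulmx_diag; congr diag_mx; apply/rowP => i; rewrite !mxE.
have [e e_ge0 de] := eig_d i; rewrite de horner_map /= pE; last first.
  by apply/mapP; exists i; rewrite ?mem_enum// de.
by rewrite -!rmorphM /= -!expr2 /r sqr_sqrtr ?sqrtr_ge0// sqr_sqrtr.
Qed.

End SymmetricMatrices.

(** * Semidefinite cone, trace product and Euclidean norm *)

Section PositiveSemidefinite.
Context {R : realType}.

Lemma psdmx0 n : psdmx (0 : 'M[R]_n).
Proof. by split=> [|z]; rewrite ?trmx0// mul0mx dotv0r. Qed.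

Lemma psdmxD n (A B : 'M[R]_n) : psdmx A -> psdmx B -> psdmx (A + B).
Proof.
move=> [AT A_ge0] [BT B_ge0]; split=> [|z]; first by rewrite linearD /= AT BT.
by rewrite mulmxDl dotvDr addr_ge0.
Qed.

Lemma psdmxZ n k (A : 'M[R]_n) : 0 <= k -> psdmx A -> psdmx (k *: A).
Proof.
move=> k_ge0 [AT A_ge0]; split=> [|z]; first by rewrite linearZ /= AT.
by rewrite -scalemxAl dotvZr mulr_ge0.
Qed.

Lemma psdmx_sum n (I : Type) (r : seq I) (P : pred I) (F : I -> 'M[R]_n) :
  (forall i, P i -> psdmx (F i)) -> psdmx (\sum_(i <- r | P i) F i).
Proof.
by move=> psdF; apply: big_ind => //; [exact: psdmx0|exact: psdmxD].
Qed.

Lemma dotv_outer n (z a b : 'cV[R]_n) :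
  dotv a ((z *m z^T) *m b) = dotv z a * dotv z b.
Proof.
rewrite -mulmxA [z^T *m b]mx11_scalar mul_mx_scalar dotvZr mulrC.
by rewrite (dotvC a).
Qed.

Lemma psdmx_outer n (z : 'cV[R]_n) : psdmx (z *m z^T).
Proof.
split=> [|a]; first by rewrite trmx_mul trmxK.
by rewrite dotv_outer -expr2 sqr_ge0.
Qed.

Lemma pdmx_psd n (A : 'M[R]_n) : pdmx A -> psdmx A.
Proof.
move=> [AT A_gt0]; split=> // z; have [->|z_neq0] := eqVneq z 0.
  by rewrite mulmx0 dotv0r.
exact/ltW/A_gt0.
Qed.

Lemma pdmx_unit n (A : 'M[R]_n) : pdmx A -> A \in unitmx.
Proof.
move=> [AT A_gt0]; rewrite -row_free_unit -kermx_eq0; apply/rowV0P => v.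
move=> /sub_kermxP vA; apply/eqP/negPn/negP => v_neq0.
have := A_gt0 v^T; rewrite trmx_eq0 => /(_ v_neq0).
by rewrite -{1}AT -trmx_mul vA trmx0 dotv0r ltxx.
Qed.

(** The square of a symmetric fourth root inhabits the set in [sqrtmx], so the default 0 is never
    taken. *)
Lemma sqrtmxP n (A : 'M[R]_n) :
  psdmx A -> psdmx (sqrtmx A) /\ sqrtmx A *m sqrtmx A = A.
Proof.
move=> /psdmx_fourth_root[T TT TA]; rewrite /sqrtmx.
case: xgetP => [S _ //|/(_ (T *m T)) []]; split=> //; split=> [|z].
  by rewrite trmx_mul TT.
rewrite -mulmxA dotv_mulmxr TT dotvE sumr_ge0// => i _.
by rewrite -expr2 sqr_ge0.
Qed.

Lemma frobdotC m n (A B : 'M[R]_(m, n)) : frobdot A B = frobdot B A.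
Proof. by rewrite /frobdot -mxtrace_tr trmx_mul trmxK. Qed.

Fact frobdot_is_scalar m n (A : 'M[R]_(m, n)) : scalar (frobdot A).
Proof.
by move=> k B C; rewrite /frobdot mulmxDr -scalemxAr mxtraceD mxtraceZ.
Qed.

HB.instance Definition _ m n (A : 'M[R]_(m, n)) :=
  GRing.isLinear.Build R 'M[R]_(m, n) R *%R (frobdot A) (frobdot_is_scalar A).

Lemma frobdotDr m n (A B C : 'M[R]_(m, n)) :
  frobdot A (B + C) = frobdot A B + frobdot A C.
Proof. exact: linearD. Qed.

Lemma frobdotZr m n k (A B : 'M[R]_(m, n)) :
  frobdot A (k *: B) = k * frobdot A B.
Proof. exact: linearZ. Qed.

Lemma frobdotDl m n (A B C : 'M[R]_(m, n)) :
  frobdot (A + B) C = frobdot A C + frobdot B C.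
Proof. by rewrite frobdotC frobdotDr !(frobdotC C). Qed.

Lemma frobdotBl m n (A B C : 'M[R]_(m, n)) :
  frobdot (A - B) C = frobdot A C - frobdot B C.
Proof. by rewrite frobdotC raddfB /= !(frobdotC C). Qed.

Lemma frobdot_outerr n (A : 'M[R]_n) z :
  frobdot A (z *m z^T) = dotv z (A *m z).
Proof.
rewrite /frobdot mulmxA mxtrace_mulC /mxtrace big_ord1.
by rewrite -[LHS]/(dotv z (A^T *m z)) dotv_mulmxr trmxK dotvC.
Qed.

Lemma frobdot_outerl n (A : 'M[R]_n) z :
  frobdot (z *m z^T) A = dotv z (A *m z).
Proof. by rewrite frobdotC frobdot_outerr. Qed.

(** With [S] the root of [B], the product is the trace of [S *m A *m S], whose diagonal entries are
    the quadratic form of [A] at the columns of [S]. *)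
Lemma frobdot_psd_ge0 n (A B : 'M[R]_n) :
  psdmx A -> psdmx B -> 0 <= frobdot A B.
Proof.
move=> [AT A_ge0] /sqrtmxP[[ST _] <-]; move: (sqrtmx B) ST => S ST.
rewrite /frobdot AT mulmxA mxtrace_mulC mulmxA /mxtrace sumr_ge0// => i _.
have := A_ge0 (col i S); rewrite /dotv tr_col ST mulmxA -row_mul !mxE.
by congr (0 <= _); apply: eq_bigr => j _; rewrite !mxE.
Qed.

Lemma norm2E n (a : 'cV[R]_n) : norm2 a = Num.sqrt (dotv a a).
Proof. by rewrite /norm2 dotvE. Qed.

Lemma dotv_self_ge0 n (a : 'cV[R]_n) : 0 <= dotv a a.
Proof. by rewrite dotvE sumr_ge0// => i _; rewrite -expr2 sqr_ge0. Qed.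

Lemma norm2_ge0 n (a : 'cV[R]_n) : 0 <= norm2 a.
Proof. exact: sqrtr_ge0. Qed.

Lemma norm2_sqr n (a : 'cV[R]_n) : norm2 a ^+ 2 = dotv a a.
Proof. by rewrite norm2E sqr_sqrtr ?dotv_self_ge0. Qed.

Lemma norm2Z n k (a : 'cV[R]_n) : 0 <= k -> norm2 (k *: a) = k * norm2 a.
Proof.
move=> k_ge0; rewrite !norm2E dotvZl dotvZr mulrA -expr2.
by rewrite sqrtrM ?sqr_ge0// sqrtr_sqr ger0_norm.
Qed.

(** For nonzero [a], expand the squared norm of [dotv a a *: b - dotv a b *: a]. *)
Lemma cauchy_schwarz n (a b : 'cV[R]_n) : dotv a b <= norm2 a * norm2 b.
Proof.
have [a0|a_gt0] := eqVneq (dotv a a) 0.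
  have -> : a = 0.
    apply/colP => i; rewrite mxE; apply/eqP; move/eqP: a0; rewrite dotvE.
    rewrite psumr_eq0 => [/allP/(_ i (mem_index_enum _))|j _]; last first.
      by rewrite -expr2 sqr_ge0.
    by rewrite /= mulf_eq0 orbb.
  by rewrite dotv0l mulr_ge0// norm2_ge0.
have {}a_gt0 : 0 < dotv a a by rewrite lt_def a_gt0 dotv_self_ge0.
rewrite (le_trans (ler_norm _))// -ler_sqr ?nnegrE ?mulr_ge0 ?norm2_ge0//.
rewrite -normrX ger0_norm ?sqr_ge0// exprMn !norm2_sqr.
have := dotv_self_ge0 (dotv a a *: b - dotv a b *: a).
rewrite !(dotvDr, dotvDl, dotvNr, dotvNl, dotvZl, dotvZr) (dotvC b a).
set X := (X in 0 <= X).
have -> : X = dotv a a * (dotv a a * dotv b b - dotv a b ^+ 2).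
  by rewrite /X; ring.
by rewrite pmulr_rge0// subr_ge0.
Qed.

Lemma ler_norm2D n (a b : 'cV[R]_n) : norm2 (a + b) <= norm2 a + norm2 b.
Proof.
rewrite -ler_sqr ?nnegrE ?addr_ge0 ?norm2_ge0// sqrrD !norm2_sqr.
rewrite dotvDl !dotvDr (dotvC b a); have := cauchy_schwarz a b; lra.
Qed.

(** Eliminates the root in favour of the quadratic form of [A]. *)
Lemma norm2_sqrtmx n (A : 'M[R]_n) (a : 'cV[R]_n) :
  psdmx A -> norm2 (sqrtmx A *m a) = Num.sqrt (dotv a (A *m a)).
Proof.
by move=> /sqrtmxP[[ST _] SA]; rewrite norm2E dotv_mulmxl ST mulmxA SA.
Qed.

End PositiveSemidefinite.

(** * Duality for the moment ambiguity set *)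

Section MomentDuality.
Context {R : realType} {d m n k N : nat}.
Variable D : bilevel_data R d m n k N.
Hypothesis hSigma0 : pdmx (Sigma0 D).
Hypothesis hgamma1 : 0 <= gamma1 D.

Let hSigma0_psd : psdmx (Sigma0 D) := pdmx_psd hSigma0.

Definition quad (xi : 'cV[R]_k) (Q : 'M[R]_k) (q : 'cV[R]_k) : R :=
  dotv xi (Q *m xi) + dotv xi q.

(** The lower bound that the semidefinite program imposes on [t]; for semidefinite [Q] it bounds the
    expectation of [quad] over [Ddis]. *)
Definition moment_bound (Q : 'M[R]_k) (q : 'cV[R]_k) : R :=
  frobdot (gamma2 D *: Sigma0 D + mu0 D *m (mu0 D)^T) Q + dotv (mu0 D) q
    + Num.sqrt (gamma1 D)
      * norm2 (sqrtmx (Sigma0 D) *m (q + 2 *: (Q *m mu0 D))).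

Definition second_moment (p : 'I_N -> R) : 'M[R]_k :=
  \sum_s p s *: ((scen D s - mu0 D) *m (scen D s - mu0 D)^T).

Lemma quadD xi Q Q' q q' :
  quad xi (Q + Q') (q + q') = quad xi Q q + quad xi Q' q'.
Proof. by rewrite /quad mulmxDl !dotvDr; ring. Qed.

Lemma quadZ xi a Q q : quad xi (a *: Q) (a *: q) = a * quad xi Q q.
Proof. by rewrite /quad -scalemxAl !dotvZr mulrDr. Qed.

Lemma moment_boundD Q Q' q q' :
  moment_bound (Q + Q') (q + q') <= moment_bound Q q + moment_bound Q' q'.
Proof.
rewrite /moment_bound frobdotDr dotvDr mulmxDl scalerDr.
rewrite (addrACA q q') mulmxDr.
set a := _ *m (q + _); set b := _ *m (q' + _).
have := ler_wpM2l (sqrtr_ge0 (gamma1 D)) (ler_norm2D a b).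
rewrite mulrDr; lra.
Qed.

Lemma moment_boundZ a Q q : 0 <= a ->
  moment_bound (a *: Q) (a *: q) = a * moment_bound Q q.
Proof.
move=> a_ge0; rewrite /moment_bound.
have -> : a *: q + 2 *: (a *: Q *m mu0 D) = a *: (q + 2 *: (Q *m mu0 D)).
  by rewrite -scalemxAl scalerDr !scalerA mulrC.
by rewrite frobdotZr dotvZr -scalemxAr norm2Z//; ring.
Qed.

Lemma moment_bound0 : moment_bound 0 0 = 0.
Proof. by have := moment_boundZ 0 0 (lexx 0); rewrite !scaler0 mul0r. Qed.

Lemma moment_bound_sum (I : Type) (r : seq I) (a : I -> R)
    (Q : I -> 'M[R]_k) (q : I -> 'cV[R]_k) : (forall i, 0 <= a i) ->
  moment_bound (\sum_(i <- r) a i *: Q i) (\sum_(i <- r) a i *: q i)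
    <= \sum_(i <- r) a i * moment_bound (Q i) (q i).
Proof.
move=> a_ge0; elim: r => [|i r IHr]; first by rewrite !big_nil moment_bound0.
rewrite !big_cons (le_trans (moment_boundD _ _ _ _))//.
by rewrite lerD// moment_boundZ.
Qed.

Lemma quad_sum (I : Type) (r : seq I) xi (a : I -> R)
    (Q : I -> 'M[R]_k) (q : I -> 'cV[R]_k) :
  quad xi (\sum_(i <- r) a i *: Q i) (\sum_(i <- r) a i *: q i)
    = \sum_(i <- r) a i * quad xi (Q i) (q i).
Proof.
elim: r => [|i r IHr]; last by rewrite !big_cons quadD quadZ IHr.
by rewrite !big_nil /quad mul0mx !dotv0r addr0.
Qed.

(* Recentering the quadratic at mu0 isolates the two constraints of Ddis. *)
Lemma moment_gapE (p : 'I_N -> R) Q q : Q^T = Q -> \sum_s p s = 1 ->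
  moment_bound Q q - \sum_s p s * quad (scen D s) Q q =
    frobdot (gamma2 D *: Sigma0 D - second_moment p) Q
    + (Num.sqrt (gamma1 D)
         * norm2 (sqrtmx (Sigma0 D) *m (q + 2 *: (Q *m mu0 D)))
       - dotv (mean_dev D p) (q + 2 *: (Q *m mu0 D))).
Proof.
move=> QT p1; pose z s := scen D s - mu0 D; pose a := q + 2 *: (Q *m mu0 D).
have meanE : mean_dev D p = \sum_s p s *: z s.
  under eq_bigr do rewrite scalerBr.
  by rewrite sumrB -scaler_suml p1 scale1r.
have quadE s : quad (scen D s) Q q = frobdot (z s *m (z s)^T) Q
    + dotv (z s) a + (dotv (mu0 D) (Q *m mu0 D) + dotv (mu0 D) q).
  have -> : scen D s = z s + mu0 D by rewrite subrK.
  move: (z s) => w.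
  rewrite frobdot_outerl /quad /a mulmxDr !(dotvDr, dotvDl) dotvZr.
  by rewrite (dotv_mulmxr (mu0 D) Q w) QT (dotvC (Q *m mu0 D) w); ring.
have -> : \sum_s p s * quad (scen D s) Q q = frobdot (second_moment p) Q
    + dotv (mean_dev D p) a + (dotv (mu0 D) (Q *m mu0 D) + dotv (mu0 D) q).
  rewrite /second_moment frobdotC raddf_sum meanE dotv_suml.
  rewrite -[X in _ + _ + X]mul1r -p1 mulr_suml -!big_split /=.
  apply: eq_bigr => s _; rewrite quadE frobdotZr (frobdotC Q) dotvZl /z; ring.
rewrite /moment_bound frobdotBl frobdotDl frobdot_outerl -/a; ring.
Qed.

(** Both parts of the gap in [moment_gapE] are nonnegative: a trace product of two semidefinite
    matrices, and a Cauchy-Schwarz term. *)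
Lemma moment_weak_duality (p : 'I_N -> R) Q q : Ddis D p -> psdmx Q ->
  \sum_s p s * quad (scen D s) Q q <= moment_bound Q q.
Proof.
move=> [p_ge0 p1 p_mean p_cov] psdQ.
rewrite -subr_ge0 moment_gapE ?psdQ.1//.
rewrite addr_ge0 ?frobdot_psd_ge0// subr_ge0.
set a := q + _; have Sunit := pdmx_unit hSigma0.
(* Splitting [Sigma0 D] into its two roots makes the squared norm of the first factor the form that
   [Ddis] bounds by [gamma1 D]. *)
have -> : dotv (mean_dev D p) a =
    dotv (sqrtmx (Sigma0 D) *m (invmx (Sigma0 D) *m mean_dev D p))
         (sqrtmx (Sigma0 D) *m a).
  have [[ST _] SS] := sqrtmxP hSigma0_psd.
  rewrite [RHS]dotv_mulmxr ST mulmxA SS mulmxA mulmxV//.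
  by rewrite mul1mx.
rewrite (le_trans (cauchy_schwarz _ _))// ler_wpM2r ?norm2_ge0//.
rewrite norm2_sqrtmx// ler_sqrt//.
by rewrite mulmxA mulmxV// mul1mx dotvC.
Qed.

Let descend (v g beta : R) : g < 0 -> exists2 t, 0 <= t & v + t * g < beta.
Proof.
move=> g_lt0; exists ((`|v - beta| + 1) / - g).
  by rewrite divr_ge0 ?addr_ge0// oppr_ge0 ltW.
rewrite invrN mulrN mulNr divfK ?lt_eqF//.
have := ler_norm (v - beta); lra.
Qed.

(** Inside [Ddis] the zero multipliers suffice; outside, the violated constraint supplies a
    direction of negative gap. *)
Lemma moment_separation (p h : 'I_N -> R) (beta : R) :
    (forall s, 0 <= p s) -> \sum_s p s = 1 ->
    (Ddis D p -> \sum_s p s * h s < beta) ->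
  exists Q q, psdmx Q /\
    \sum_s p s * (h s - quad (scen D s) Q q) + moment_bound Q q < beta.
Proof.
move=> p_ge0 p1 h_lt.
have valE Q q : \sum_s p s * (h s - quad (scen D s) Q q) + moment_bound Q q
    = \sum_s p s * h s
      + (moment_bound Q q - \sum_s p s * quad (scen D s) Q q).
  under eq_bigr do rewrite mulrBr.
  by rewrite sumrB; ring.
(* The gap is positively homogeneous in [(Q, q)], so following a direction where it is negative
   brings the value below [beta]. *)
have along Q q : psdmx Q ->
    moment_bound Q q - \sum_s p s * quad (scen D s) Q q < 0 ->
  exists Q q, psdmx Q /\
    \sum_s p s * (h s - quad (scen D s) Q q) + moment_bound Q q < beta.
  move=> psdQ /(descend (\sum_s p s * h s) beta)[t t_ge0 lt_beta].
  exists (t *: Q), (t *: q); split; first exact: psdmxZ.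
  rewrite valE moment_boundZ//.
  under [X in _ - X]eq_bigr do rewrite quadZ mulrCA.
  by rewrite -mulr_sumr -mulrBr.
have [p_cov|p_cov] :=
  pselect (lemx_psd (second_moment p) (gamma2 D *: Sigma0 D)).
  have [p_mean|p_mean] := leP (dotv (mean_dev D p)
      (invmx (Sigma0 D) *m mean_dev D p)) (gamma1 D).
    exists 0, 0; split; first exact: psdmx0.
    rewrite valE moment_bound0 [X in _ - X]big1 ?subr0 ?addr0 => [|s _].
      exact: h_lt.
    by rewrite /quad mul0mx !dotv0r addr0 mulr0.
  (* With [e] the squared deviation, the gap here is [sqrt gamma1 * sqrt e - e], negative since
     [e > gamma1]. *)
  apply: (along 0 (invmx (Sigma0 D) *m mean_dev D p)); first exact: psdmx0.
  rewrite moment_gapE ?trmx0// mul0mx scaler0 addr0 raddf0 add0r.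
  rewrite norm2_sqrtmx// mulmxA mulmxV ?pdmx_unit// mul1mx.
  rewrite (dotvC _ (mean_dev D p)).
  set e := dotv _ _ in p_mean *.
  have e_gt0 : 0 < e := le_lt_trans hgamma1 p_mean.
  rewrite subr_lt0 -[ltRHS](sqr_sqrtr (ltW e_gt0)) expr2 ltr_pM2r ?sqrtr_gt0//.
  by rewrite ltr_sqrt.
have [z z_lt0] : exists z,
    dotv z ((gamma2 D *: Sigma0 D - second_moment p) *m z) < 0.
  apply: contrapT => no_z; apply: p_cov; split=> [|z]; last first.
    by rewrite leNgt; apply/negP => z_lt0; apply: no_z; exists z.
  rewrite linearB linearZ /= hSigma0_psd.1; congr (_ - _).
  rewrite /second_moment linear_sum /=; apply: eq_bigr => s _.
  by rewrite linearZ /= trmx_mul trmxK.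
(* This [q] cancels [2 *: (Q *m mu0 D)], so only the covariance part of the gap remains. *)
apply: (along (z *m z^T) (- (2 *: ((z *m z^T) *m mu0 D)))).
  exact: psdmx_outer.
rewrite moment_gapE// ?(psdmx_outer z).1// addNr mulmx0 dotv0r subr0.
by rewrite norm2E dotv0r sqrtr0 mulr0 addr0 frobdot_outerr.
Qed.

(** Row vectors replace the functions of [Ddis] so that [rV_compact] applies. *)
Let simplex : set 'rV[R]_N :=
  [set p | (forall s, 0 <= p 0 s) /\ \sum_s p 0 s = 1].

Let continuous_lin (a : 'I_N -> R) :
  continuous (fun p : 'rV[R]_N => \sum_s p 0 s * a s).
Proof.
apply: continuous_big => [|s _ p]; first exact: add_continuous.
apply: (continuousM (@coord_continuous R 1 N 0 s p)); exact: cst_continuous.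
Qed.

Let compact_simplex : compact simplex.
Proof.
have -> : simplex = [set p : 'rV[R]_N | forall s, `[0, 1]%classic (p ord0 s)]
    (* The factor 1 gives the sum the shape treated by [continuous_lin]. *)
    `&` [set p | \sum_s p 0 s * 1 = 1].
  have mulr1_sum (p : 'rV[R]_N) : \sum_s p 0 s * 1 = \sum_s p 0 s.
    by apply: eq_bigr => s _; rewrite mulr1.
  apply/seteqP; split=> p [p_ge0 p1]; split.
  - move=> s; rewrite /= in_itv /= p_ge0 -p1 (bigD1 s)//= lerDl.
    exact: sumr_ge0.
  - by rewrite /= mulr1_sum.
  - by move=> s; have := p_ge0 s; rewrite /= in_itv /= => /andP[].
  - by rewrite -mulr1_sum.
apply: compact_closedI.
  have := @rV_compact R N (fun=> `[0, 1]%classic).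
  by apply=> _; exact: segment_compact.
apply: (@preimage_closed _ _ (fun p : 'rV[R]_N => \sum_s p 0 s * 1) [set 1]).
  by move=> p _; exact: continuous_lin.
exact: closed_eq.
Qed.

Lemma moment_strong_duality (h : 'I_N -> R) (beta : R) :
    (forall p, Ddis D p -> \sum_s p s * h s < beta) ->
  exists Q q, psdmx Q /\
    forall s, h s - quad (scen D s) Q q + moment_bound Q q <= beta.
Proof.
move=> h_lt.
pose val (i : 'M[R]_k * 'cV[R]_k) s :=
  h s - quad (scen D s) i.1 i.2 + moment_bound i.1 i.2.
pose U i := [set p : 'rV[R]_N | \sum_s p 0 s * val i s < beta].
have := compact_simplex; rewrite compact_cover.
move=> /(_ _ [set i | psdmx i.1] U)[i _|p [p_ge0 p1]|J J_psd J_cover].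
- apply: (@open_comp _ _ (fun p : 'rV[R]_N => \sum_s p 0 s * val i s)
    [set x | x < beta]); last exact: open_lt.
  by move=> p _; exact: continuous_lin.
- have [Q [q [psdQ lt_beta]]] := moment_separation p_ge0 p1 (h_lt (p 0)).
  exists (Q, q) => //; rewrite /U /= /val /=.
  under eq_bigr do rewrite mulrDr.
  by rewrite big_split/= -mulr_suml p1 mul1r.
(* A point where all these forms are nonpositive has nonnegative entries; with positive total mass
   it would normalize to a point of the simplex missed by the cover. *)
pose a (i : J + 'I_N) (p : 'rV[R^o]_N) : R :=
  match i with
  | inl i => \sum_s p 0 s * (beta - val (fsval i) s)
  | inr s => - p 0 s
  end.
have scalar_sum (f : 'I_N -> R) :
    scalar (fun p : 'rV[R]_N => \sum_s p 0 s * f s).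
  move=> c x y; rewrite mulr_sumr -big_split; apply: eq_bigr => s _.
  by rewrite !mxE mulrDl mulrA.
have [[i|s]||p p_le|u u_ge0 uE] :=
  @farkas R 'rV[R]_N _ a (fun p => \sum_s p 0 s * 1) _ _ _.
- exact: scalar_sum.
- by move=> c x y; rewrite /= !mxE opprD mulrN.
- exact: scalar_sum.
- under eq_bigr do rewrite mulr1.
  have p_ge0 s : 0 <= p 0 s by have := p_le (inr s); rewrite oppr_le0.
  rewrite leNgt; apply/negP => p_gt0; pose c := \sum_s p 0 s.
  have [|i /= iJ] := J_cover (c^-1 *: p).
    split=> [s|]; first by rewrite mxE mulr_ge0// invr_ge0 ltW.
    under eq_bigr do rewrite mxE.
    by rewrite -mulr_sumr mulVf ?gt_eqF.
  rewrite /U /=; under eq_bigr do rewrite mxE -mulrA.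
  rewrite -mulr_sumr mulrC ltr_pdivrMr// ltNge => /negP; apply.
  have := p_le (inl [` iJ]%fset); rewrite /a /=.
  under eq_bigr do rewrite mulrBr.
  by rewrite sumrB -mulr_suml subr_le0 mulrC.
pose mu i := u (inl i); pose M := \sum_i mu i.
have mu_ge0 i : 0 <= mu i by exact: u_ge0.
(* Evaluate the Farkas identity at the unit vectors; the multipliers of the sign constraints only
   lower its right side. *)
have le_sum s : 1 <= \sum_i mu i * (beta - val (fsval i) s).
  have := uE (delta_mx 0 s); rewrite big_sumType /=.
  have sum_delta (f : 'I_N -> R) :
      \sum_t (delta_mx 0 s : 'rV_N) 0 t * f t = f s.
    rewrite (bigD1 s)//= mxE !eqxx mul1r big1 ?addr0// => t ts.
    by rewrite mxE (negPf ts) andbF mul0r.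
  rewrite sum_delta => ->.
  under eq_bigr do rewrite sum_delta.
  rewrite gerDl; apply: sumr_le0 => t _.
  by rewrite mulrN oppr_le0 mulr_ge0// mxE ler0n.
(* [M] can vanish only when there is no scenario: otherwise [le_sum] would read [1 <= 0]. *)
have [M0|M_neq0] := eqVneq M 0.
  exists 0, 0; split=> [|s]; first exact: psdmx0.
  have mu0 i : mu i = 0.
    apply/eqP; move/eqP: M0; rewrite psumr_eq0// => /allP/(_ i).
    by rewrite mem_index_enum; exact.
  by have := le_sum s; rewrite big1 ?ler10// => i _; rewrite mu0 mul0r.
have M_gt0 : 0 < M by rewrite lt_def M_neq0 sumr_ge0.
pose nu i := mu i / M.
have nu_ge0 i : 0 <= nu i by rewrite divr_ge0 ?(ltW M_gt0).
have nu1 : \sum_i nu i = 1 by rewrite -mulr_suml divff.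
exists (\sum_i nu i *: (fsval i).1), (\sum_i nu i *: (fsval i).2).
split=> [|s].
  apply: psdmx_sum => i _; apply: psdmxZ => //.
  by have := J_psd _ (fsvalP i); rewrite inE.
have : \sum_i nu i * val (fsval i) s <= beta.
  rewrite -subr_ge0 -[beta]mul1r -nu1 mulr_suml -sumrB.
  under eq_bigr do rewrite -mulrBr /nu mulrAC.
  by rewrite -mulr_suml divr_ge0 ?(ltW M_gt0)// (le_trans _ (le_sum s)).
apply: le_trans; rewrite /val quad_sum.
under [leRHS]eq_bigr do rewrite mulrDr mulrBr.
rewrite big_split sumrB -mulr_suml nu1 mul1r lerD2l.
exact: moment_bound_sum.
Qed.

End MomentDuality.

(** * Duality for the pessimistic follower value *)

Lemma bounded_set_dotv {R : realType} n (P : set 'cV[R]_n) (c : 'cV[R]_n) :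
  bounded_set P -> exists B, forall y, P y -> dotv c y <= B.
Proof.
(* Boundedness is guaranteed only for radii strictly above [M], hence [M + 1]. *)
move=> [M [_ bndM]]; exists (\sum_i `|c i 0| * (M + 1)) => y Py.
have {bndM} := bndM (M + 1) _ y Py; rewrite ltrDl ltr01 => /(_ isT) y_le.
rewrite dotvE (le_trans (ler_norm _))// (le_trans (ler_norm_sum _ _ _))//.
apply: ler_sum => i _; rewrite normrM ler_wpM2l//; apply: le_trans y_le.
rewrite [leRHS]/Num.norm /= mx_normrE.
by apply/bigmax_geP; right; exists (i, 0).
Qed.

Section FollowerDuality.
Context {R : realType} {m n : nat}.
Variables (A : 'M[R]_(m, n)) (b : 'cV[R]_m) (c v : 'cV[R]_n).

Let P : set 'cV[R]_n := [set y | lecv (A *m y) b].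
Let argmin : set 'cV[R]_n :=
  [set y | P y /\ forall y', P y' -> dotv c y <= dotv c y'].

(* With phi the lower-level optimal value, A y <= lam b forces c y >= lam phi,
   with equality at lam times a lower-level optimum, so that c y stands in for
   the dual term lam * phi.  Adding multiples of an optimal dual pi of the lower
   level to (p, lam) makes lam arbitrarily large. *)
Lemma pessimistic_duality : P !=set0 -> bounded_set P ->
  exists h, [/\ ereal_sup [set (dotv v y)%:E | y in argmin] = h%:E,
    forall lam p y, 0 <= lam -> lecv 0 p -> A^T *m p + lam *: c = v ->
      lecv (A *m y) (lam *: b) -> h <= dotv b p + dotv c y
    & exists2 lam0, 0 <= lam0 & forall lam, lam0 <= lam ->
      exists p y, [/\ lecv 0 p, A^T *m p + lam *: c = v,
        lecv (A *m y) (lam *: b) & dotv b p + dotv c y = h]].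
Proof.
move=> P0 Pbnd.
have [B le_B] := bounded_set_dotv (- c) Pbnd.
have [y0 [pi [Py0 pi_ge0 Api bpi]]] := lp_duality P0 le_B.
have y0_min y : P y -> dotv c y0 <= dotv c y.
  move=> Py; rewrite -lerN2 -!dotvNl -bpi -Api -dotv_mulmxr (dotvC b).
  exact: ler_dotv.
set phi := dotv c y0.
have phiE : dotv b pi = - phi by rewrite bpi dotvNl.
(* The added row [c y <= phi] describes the lower-level optima as a polyhedron, so [lp_duality]
   applies again; the multiplier of this row is [lam0]. *)
pose A1 := col_mx A c^T; pose b1 : 'cV_(m + 1) := col_mx b (const_mx phi).
have A1P y : lecv (A1 *m y) b1 <-> argmin y.
  rewrite mul_col_mx lecv_col_mx; split=> [[Py cy]|[Py y_min]]; split=> //.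
  - move=> y' /y0_min; apply: le_trans; have := cy 0.
    by rewrite [leRHS]mxE.
  - by move=> i; rewrite !ord1 [leRHS]mxE; exact: y_min.
have [B1 le_B1] := bounded_set_dotv v Pbnd.
have [||y1 [u [/A1P y1_argmin u_ge0 A1u b1u]]] := @lp_duality _ _ _ A1 b1 v B1.
- by exists y0; apply/A1P.
- by move=> y /A1P[Py _]; exact: le_B1.
move: u_ge0 A1u b1u; rewrite -[u]vsubmxK -(col_mx0 _ m 1).
move: (usubmx u) (dsubmx u) => p t /lecv_col_mx[p_ge0 t_ge0].
rewrite tr_col_mx trmxK mul_row_col [t]mx11_scalar mul_mx_scalar dotv_col_mx.
move: (t 0 0) (t_ge0 0) => lam0; rewrite mxE => lam0_ge0 pv.
rewrite (dotvE (const_mx phi)) big_ord1 !mxE mulr1n => b1u.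
exists (dotv v y1); split.
- apply/le_anti/andP; split.
    apply: ge_ereal_sup => _ [y y_argmin <-]; rewrite lee_fin.
    rewrite -b1u -pv dotvDl dotvZl -dotv_mulmxr (dotvC b) (mulrC phi).
    rewrite lerD ?ler_dotv ?ler_wpM2l//; first by case: y_argmin.
    by case: y_argmin => _; exact.
  by apply: ereal_sup_ubound; exists y1.
- move=> lam q y lam_ge0 q_ge0 <- Ay; have [Py1 y1_min] := y1_argmin.
  rewrite dotvDl dotvZl -dotv_mulmxr (dotvC b) lerD ?ler_dotv//.
  rewrite (@le_trans _ _ (lam * phi)) ?ler_wpM2l ?y1_min//.
  rewrite -lerN2 -mulrN -phiE -dotvZl -dotvNl -Api -dotv_mulmxr.
  by rewrite (dotvC (lam *: b)) ler_dotv.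
- exists lam0 => // lam le_lam; have lam_ge0 := le_trans lam0_ge0 le_lam.
  (* Raising [lam] changes the [b] term by [- (lam - lam0) * phi], which the [c] term at [lam *: y0]
     compensates. *)
  exists (p + (lam - lam0) *: pi), (lam *: y0); split.
  + move=> i; have := p_ge0 i; have := pi_ge0 i; rewrite !mxE => pi_i p_i.
    by rewrite addr_ge0// mulr_ge0// subr_ge0.
  + rewrite mulmxDr -scalemxAr Api -pv scalerN scalerBl.
    by rewrite opprB -addrA subrK.
  + move=> i; rewrite -scalemxAr !mxE ler_wpM2l//.
    by have := Py0 i; rewrite mxE.
  + rewrite dotvDr !dotvZr phiE -/phi -b1u; ring.
Qed.

End FollowerDuality.

(** * Big-M linearization and equivalence of the two programs *)

Section Reformulation.
Context {R : realType} {d m n k N : nat}.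
Variable D : bilevel_data R d m n k N.
Hypothesis hX : forall x, Xset D x -> forall i, x i 0 = 0 \/ x i 0 = 1.
Hypothesis hSigma0 : pdmx (Sigma0 D).
Hypothesis hgamma1 : 0 <= gamma1 D.
Hypothesis hrecourse : relatively_complete_recourse D.

Lemma rhsE x xi :
  rhs D x xi = \sum_i x i 0 *: rhs_coef D i xi + rhs_coef0 D xi.
Proof.
rewrite /rhs /rhs_coef /rhs_coef0 mulmxDl addrACA; congr (_ + _).
rewrite mulmx_suml -big_split; apply: eq_bigr => i _ /=.
by rewrite -scalemxAl scalerDr.
Qed.

Lemma dotv_rhs x xi (p : 'cV[R]_m) :
  dotv (rhs D x xi) p =
    \sum_i dotv (rhs_coef D i xi) (x i 0 *: p) + dotv (rhs_coef0 D xi) p.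
Proof.
rewrite rhsE dotvDl dotv_suml; congr (_ + _); apply: eq_bigr => i _.
by rewrite dotvZl dotvZr.
Qed.

Lemma scale_rhs lam x xi :
  lam *: rhs D x xi =
    \sum_i (x i 0 * lam) *: rhs_coef D i xi + lam *: rhs_coef0 D xi.
Proof.
rewrite rhsE scalerDr scaler_sumr; congr (_ + _); apply: eq_bigr => i _.
by rewrite scalerA mulrC.
Qed.

(** Whatever [M] is, each binary value of [x i 0] collapses some of the big-M bounds to equalities;
    the size of [M] matters only in the converse. *)
Lemma sdp_feasible_linearization M x Q q r t lam theta p y omega :
    sdp_feasible D M x (SdpVars Q q r t lam theta p y omega) ->
  theta = (fun i => x i 0 * lam) /\ omega = (fun i s => x i 0 *: p s).
Proof.
move=> [/hX x01 _ _ omegaP [thetaP theta_lam _ _]].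
split; apply/funext => i; last apply/funext => s.
  have /andP[] := thetaP i; have /andP[] := theta_lam i.
  by case: (x01 i) => ->; lra.
have [om1 om2 om3 om4] := omegaP i s.
apply/colP => j; move: (om1 j) (om2 j) (om3 j) (om4 j); rewrite !mxE.
by case: (x01 i) => ->; lra.
Qed.

(** Bounding [lam] and the entries of [p] by [M] keeps the remaining big-M constraints satisfied. *)
Lemma sdp_feasible_of_linearization (M : R) x Q q r t (lam : R)
    (p : 'I_N -> 'cV[R]_m) (y : 'I_N -> 'cV[R]_n) :
    Xset D x -> 0 <= lam <= M -> (forall s i, p s i 0 <= M) ->
    (forall s : 'I_N, [/\ dotv (rhs D x (scen D s)) (p s)
        + dotv (cost D (scen D s)) (y s) - quad (scen D s) Q q <= r,
      (Amat D)^T *m p s + lam *: cost D (scen D s) = vcost D (scen D s),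
      lecv (Amat D *m y s) (lam *: rhs D x (scen D s)) & lecv 0 (p s)]) ->
    moment_bound D Q q <= t -> psdmx Q ->
  sdp_feasible D M x (SdpVars Q q r t lam (fun i => x i 0 * lam) p y
                       (fun i s => x i 0 *: p s)).
Proof.
move=> Xx /andP[lam_ge0 lam_le] p_le follower_ok t_ge psdQ.
have x01 := hX Xx; split=> //.
- move=> s; have [r_ge Ap Ay p_ge0] := follower_ok s; split=> //; last first.
    by rewrite -scale_rhs.
  by move: r_ge; rewrite dotv_rhs /quad; lra.
- move=> i s; have [_ _ _ p_ge0] := follower_ok s.
  split=> j; move: (p_le s j) (p_ge0 j); rewrite !mxE;
    by case: (x01 i) => ->; lra.
- split=> // i; apply/andP; split; case: (x01 i) => ->; lra.
Qed.

Lemma bilevel_objE x (h : 'I_N -> R) :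
    (forall s, pessimistic_value D x (scen D s) = (h s)%:E) ->
  bilevel_obj D x = ((dotv (wvec D) x)%:E
    + ereal_sup [set (\sum_s p s * h s)%:E | p in Ddis D])%E.
Proof.
move=> hE; rewrite /bilevel_obj; congr (_ + ereal_sup _)%E.
apply: eq_imagel => p _; rewrite /dis_expectation -sumEFin.
by apply: eq_bigr => s _; rewrite hE EFinM.
Qed.

(** Reduces the comparison to real strict upper bounds of [S], also for infinite [S]; an empty
    [Ddis] leads to [S = -oo]. *)
Let lee_EFinD (w : R) (I S : \bar R) :
  (forall beta : R, (S < beta%:E)%E -> (I <= (w + beta)%:E)%E) ->
  (I <= w%:E + S)%E.
Proof.
case: S => [r| |] le_I; last 2 first.
- by rewrite addey// leey.
- rewrite addeNy leNgt; apply/negP; case: I le_I => [r| |]// le_I _.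
    have := le_I (r - w - 1) (ltNyr _); rewrite lee_fin; lra.
  by have := le_I 0 (ltNyr _); rewrite leye_eq.
apply/lee_addgt0Pr => e e_gt0; rewrite -!EFinD -addrA; apply: le_I.
by rewrite lte_fin ltrDl.
Qed.

Lemma bilevel_obj_sdp_value_at x : Xset D x ->
  exists Mx, forall M, Mx <= M -> bilevel_obj D x = sdp_value_at D M x.
Proof.
move=> Xx.
have /choice[h hP] s := pessimistic_duality
  (cost D (scen D s)) (vcost D (scen D s))
  (hrecourse s Xx).1 (hrecourse s Xx).2.
have /choice[lam0 lam0P] s :
  exists lam0, 0 <= lam0 /\ forall lam, lam0 <= lam ->
    exists z : 'cV[R]_m * 'cV[R]_n, [/\ lecv 0 z.1,
      (Amat D)^T *m z.1 + lam *: cost D (scen D s) = vcost D (scen D s),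
      lecv (Amat D *m z.2) (lam *: rhs D x (scen D s))
    & dotv (rhs D x (scen D s)) z.1 + dotv (cost D (scen D s)) z.2 = h s].
  have [_ _ [lam0 lam0_ge0 lam0P]] := hP s; exists lam0; split=> // lam.
  by move=> /lam0P[p [y ?]]; exists (p, y).
pose lam := \sum_s lam0 s.
have lam_ge s : lam0 s <= lam.
  rewrite /lam (bigD1 s)//= lerDl sumr_ge0// => t _.
  by case: (lam0P t).
have /choice[z zP] s := (lam0P s).2 _ (lam_ge s).
(* Sums of absolute values serve as a crude maximum over all scenarios and entries. *)
pose Mx := lam + \sum_s \sum_i `|(z s).1 i 0|.
have lam_ge0 : 0 <= lam by apply: sumr_ge0 => s _; case: (lam0P s).
exists Mx => M le_M.
have lam_le : lam <= M.
  by rewrite (le_trans _ le_M)// lerDl sumr_ge0// => s _; rewrite sumr_ge0.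
have p_le s i : (z s).1 i 0 <= M.
  rewrite (le_trans _ le_M)// (le_trans (ler_norm _))//.
  rewrite /Mx (bigD1 s)//= (bigD1 i)//= addrCA -addrA lerDl.
  by rewrite !addr_ge0// sumr_ge0// => t _; rewrite sumr_ge0.
rewrite (bilevel_objE (h := h)) => [|s]; last by case: (hP s).
apply/le_anti/andP; split.
  (* Weak duality at both levels: [h s] lies below [r + quad], whose expectation under any [p] in
     [Ddis] is at most [r + t]. *)
  apply: le_ereal_inf_tmp => _ [u u_feas <-].
  rewrite /sdp_obj -addrA EFinD leeD2l//; apply: ge_ereal_sup => _ [p Dp <-].
  rewrite lee_fin.
  case: u u_feas => Q q r t mu theta pp y omega u_feas /=.
  have [thetaE omegaE] := sdp_feasible_linearization u_feas; subst theta omega.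
  case: u_feas => _ follower_ok t_ge _ [_ _ psdQ mu_ge0].
  have h_le s : h s <= r + quad (scen D s) Q q.
    have [r_ge Ap Ay p_ge0] := follower_ok s; have [_ h_weak _] := hP s.
    have := h_weak mu (pp s) (y s) mu_ge0 p_ge0 Ap.
    rewrite scale_rhs dotv_rhs => /(_ Ay).
    by move: r_ge; rewrite /quad; lra.
  have [p_ge0 p1 _ _] := Dp.
  have := moment_weak_duality hSigma0 hgamma1 q Dp psdQ.
  have : \sum_s p s * h s <= \sum_s p s * (r + quad (scen D s) Q q).
    by apply: ler_sum => s _; apply: ler_wpM2l.
  under [leRHS]eq_bigr do rewrite mulrDr.
  rewrite big_split -mulr_suml p1 mul1r /=.
  move: t_ge; rewrite -/(moment_bound D Q q); lra.
apply: lee_EFinD => beta sup_lt.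
have [p Dp|Q [q [psdQ le_beta]]] :=
  moment_strong_duality hSigma0 hgamma1 (h := h) (beta := beta).
  rewrite -lte_fin (le_lt_trans _ sup_lt)//; apply: ereal_sup_ubound.
  by exists p.
(* Here [r] and [t] add up to [beta], with [t] at its smallest admissible value. *)
pose u := SdpVars Q q (beta - moment_bound D Q q) (moment_bound D Q q) lam
  (fun i => x i 0 * lam) (fun s => (z s).1) (fun s => (z s).2)
  (fun i s => x i 0 *: (z s).1).
apply: ereal_inf_lbound; exists u; last first.
  by rewrite /sdp_obj /= -addrA subrK.
apply: sdp_feasible_of_linearization => //; first by rewrite lam_ge0.
move=> s; have [p_ge0 Ap Ay hE] := zP s; split=> //.
by rewrite hE; have := le_beta s; lra.
Qed.

(* Xset D is finite, being a set of 0-1 vectors. *)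
Lemma Xset_uniform_bound (P : 'cV[R]_d -> R -> Prop) :
    (forall x, Xset D x -> exists Mx, forall M, Mx <= M -> P x M) ->
  exists2 M0, 0 < M0 & forall M x, M0 <= M -> Xset D x -> P x M.
Proof.
move=> PX; pose vec (f : {ffun 'I_d -> bool}) : 'cV[R]_d := \col_i (f i)%:R.
have /choice[Mf MfP] f : exists Mf, Xset D (vec f) ->
    forall M, Mf <= M -> P (vec f) M.
  have [/PX[Mf MfP]|nX] := pselect (Xset D (vec f)); first by exists Mf.
  by exists 0.
exists (1 + \sum_f `|Mf f|) => [|M x le_M Xx].
  by rewrite ltr_wpDr// sumr_ge0.
pose f : {ffun 'I_d -> bool} := [ffun i => x i 0 == 1].
have xE : x = vec f.
  apply/colP => i; rewrite mxE ffunE.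
  by case: (hX Xx i) => ->; rewrite ?eqxx// eq_sym oner_eq0.
rewrite xE; apply: MfP; first by rewrite -xE.
rewrite (le_trans _ le_M)// (le_trans (ler_norm _))// (bigD1 f)//=.
by rewrite addrCA lerDl addr_ge0// sumr_ge0.
Qed.

End Reformulation.

(** Iterated infimum; an [x] in [Xset D] with no feasible completion contributes [+oo]. *)
Lemma sdp_value_infE {R : realType} {d m n k N : nat}
    (D : bilevel_data R d m n k N) (M : R) :
  sdp_value D M = ereal_inf [set sdp_value_at D M x | x in Xset D].
Proof.
apply/le_anti/andP; split; apply: le_ereal_inf_tmp.
  move=> _ [x Xx <-]; apply: le_ereal_inf_tmp => _ [u u_feas <-].
  by apply: ereal_inf_lbound; exists (x, u).
move=> _ [[x u] /= u_feas <-].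
have Xx : Xset D x by case: u u_feas => Q q r t lam th p y om [].
apply: (@le_trans _ _ (sdp_value_at D M x)); apply: ereal_inf_lbound.
  by exists x.
by exists u.
Qed.

Theorem theorem4 (R : realType) (d m n k N : nat)
    (D : bilevel_data R d m n k N)
    (hX : forall x, Xset D x -> forall i, x i 0 = 0 \/ x i 0 = 1)
    (hSigma0 : pdmx (Sigma0 D))
    (hgamma1 : 0 <= gamma1 D)
    (hgamma2 : 1 <= gamma2 D)
    (hrecourse : relatively_complete_recourse D) :
  exists2 M0 : R, 0 < M0 &
    forall M : R, M0 <= M ->
      [/\ bilevel_value D = sdp_value D M,
          forall x, bilevel_optimal D x <-> sdp_optimal D M x
        & forall x u, sdp_minimizer D M x u -> bilevel_optimal D x].
Proof.
have [M0 M0_gt0 objE] := Xset_uniform_bound hX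
  (bilevel_obj_sdp_value_at hX hSigma0 hgamma1 hrecourse).
exists M0 => // M le_M; have {le_M}objE x := objE M x le_M.
have valE : bilevel_value D = sdp_value D M.
  by rewrite sdp_value_infE; congr ereal_inf; exact: eq_imagel.
have optE x : bilevel_optimal D x <-> sdp_optimal D M x.
  by split=> -[Xx objx]; split; rewrite // ?valE ?objE// -objE// -valE.
split=> // x u [u_feas u_min]; apply/optE.
have Xx : Xset D x by case: u u_feas {u_min} => Q q r t lam th p y om [].
split=> //; apply/le_anti/andP; split; last first.
  rewrite sdp_value_infE; apply: ereal_inf_lbound.
  by exists x.
(* The objective at the minimizer lies between the partial infimum at [x] and the joint infimum. *)
apply: (@le_trans _ _ (sdp_obj D x u)%:E).
  by apply: ereal_inf_lbound; exists u.
apply: le_ereal_inf_tmp => _ [[x' u'] /= u'_feas <-].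
by rewrite lee_fin u_min.
Qed.
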